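(* Let $s\in(0,1/2)$, let $\mathcal{N}\subset\mathbb{R}^d$ be a compact smooth submanifold without boundary, let $\omega\subset\mathbb{R}$ be a bounded open interval, and let $\{u_n\}_{n\in\mathbb{N}}\subset\widehat H^s(\omega;\mathcal{N})$ be a sequence of minimizing $s$-harmonic maps in $\omega$. Assume that $\sup_n\mathcal{E}_s(u_n,\omega)<\infty$ and $u_n\to u$ in $L^2_{\rm loc}(\mathbb{R})$. Then $u\in\widehat H^s(\omega;\mathcal{N})$ is a minimizing $s$-harmonic map in $\omega$, $u_n\to u$ strongly in $H^s_{\rm loc}(\omega)$, and $\mathcal{E}_s(u_n,\omega')\to\mathcal{E}_s(u,\omega')$ for every open interval $\omega'$ with $\overline{\omega'}\subset\omega$.
   Context: For a bounded open interval $\omega\subset\mathbb{R}$ and a measurable $u:\mathbb{R}\to\mathbb{R}^d$, the fractional $s$-energy is $$\mathcal{E}_s(u,\omega):=\frac{\gamma_s}{2}\iint_{\omega\times\omega}\frac{|u(x)-u(y)|^2}{|x-y|^{1+2s}}\,dxdy+\gamma_s\iint_{\omega\times(\mathbb{R}\setminus\omega)}\frac{|u(x)-u(y)|^2}{|x-y|^{1+2s}}\,dxdy,$$ with $\gamma_s:=s2^{2s}\pi^{-1/2}\Gamma(\frac{1+2s}{2})/\Gamma(1-s)$. $\widehat H^s(\omega;\mathbb{R}^d)$ is the space of $u\in L^2_{\rm loc}(\mathbb{R};\mathbb{R}^d)$ with $\mathcal{E}_s(u,\omega)<\infty$, and $\widehat H^s(\omega;\mathcal{N})$ is the set of such $u$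 with $u(x)\in\mathcal{N}$ for a.e. $x\in\mathbb{R}$. A map $u\in\widehat H^s(\omega;\mathcal{N})$ is a minimizing $s$-harmonic map in $\omega$ if $\mathcal{E}_s(u,\omega)\le\mathcal{E}_s(\tilde u,\omega)$ for every $\tilde u\in\widehat H^s(\omega;\mathcal{N})$ with ${\rm spt}(\tilde u-u)\subset\omega$. Strong convergence in $H^s_{\rm loc}(\omega)$ means convergence in the Sobolev–Slobodeckij space $H^s(\omega')$ for every open interval $\omega'$ with $\overline{\omega'}\subset\omega$. *)

(* Defs.v *)
From HB Require Import structures.
From mathcomp Require Import all_boot all_order all_algebra.
From mathcomp Require Import all_classical all_reals all_analysis.
Set Implicit Arguments. Unset Strict Implicit. Unset Printing Implicit Defensive.
Import Order.TTheory GRing.Theory Num.Theory.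
Import numFieldNormedType.Exports.
Local Open Scope classical_set_scope.
Local Open Scope ring_scope.

Definition Gamma (R : realType) (x : R) : R :=
  fine (\int[@lebesgue_measure R]_(t in `]0%R, +oo[%classic)
          (powR t (x - 1) * expR (- t))%:E)%E.

Definition gamma_s (R : realType) (s : R) : R :=
  s * powR 2 (2 * s) * (powR pi (- 2^-1)) * Gamma ((1 + 2 * s) / 2)
  / Gamma (1 - s).

Definition sqnorm (R : realType) (d : nat) (v : 'rV[R]_d) : R :=
  \sum_(i < d) (v ord0 i) ^+ 2.

Definition skernel (R : realType) (d : nat) (s : R) (u : R -> 'rV[R]_d)
  (z : R * R) : \bar R :=
  (sqnorm (u z.1 - u z.2) / powR `|z.1 - z.2| (1 + 2 * s))%:E.

Definition leb2 (R : realType) :=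
  ((@lebesgue_measure R) \x (@lebesgue_measure R))%E.

Definition energy (R : realType) (d : nat) (s : R) (u : R -> 'rV[R]_d)
  (w : set R) : \bar R :=
  ((gamma_s s / 2)%:E * \int[@leb2 R]_(z in w `*` w) skernel s u z
   + (gamma_s s)%:E * \int[@leb2 R]_(z in w `*` ~` w) skernel s u z)%E.

Definition gagliardo (R : realType) (d : nat) (s : R) (u : R -> 'rV[R]_d)
  (w : set R) : \bar R :=
  (\int[@leb2 R]_(z in w `*` w) skernel s u z)%E.

Definition L2sq (R : realType) (d : nat) (u : R -> 'rV[R]_d) (A : set R)
  : \bar R :=
  (\int[@lebesgue_measure R]_(x in A) (sqnorm (u x))%:E)%E.

Definition L2loc (R : realType) (d : nat) (u : R -> 'rV[R]_d) : Prop :=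
  (forall i : 'I_d, measurable_fun setT (fun x => u x ord0 i)) /\
  (forall a b : R, (L2sq u `[a, b] < +oo)%E).

Definition Hhat (R : realType) (d : nat) (s : R) (w : set R)
  (u : R -> 'rV[R]_d) : Prop :=
  L2loc u /\ (energy s u w < +oo)%E.

Definition HhatN (R : realType) (d : nat) (s : R) (w : set R)
  (N : set 'rV[R]_d) (u : R -> 'rV[R]_d) : Prop :=
  Hhat s w u /\ {ae @lebesgue_measure R, forall x, N (u x)}.

(* minimizing s-harmonic map in w = ]alpha, beta[ : competitors v with
   spt(v - u) contained in w, i.e. v = u a.e. outside some [a,b] in w *)
Definition min_sharmonic (R : realType) (d : nat) (s alpha beta : R)
  (N : set 'rV[R]_d) (u : R -> 'rV[R]_d) : Prop :=
  HhatN s `]alpha, beta[ N u /\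
  forall v : R -> 'rV[R]_d, HhatN s `]alpha, beta[ N v ->
    (exists a b : R, alpha < a /\ b < beta /\
       {ae @lebesgue_measure R, forall x, ~ `[a, b]%classic x -> v x = u x}) ->
    (energy s u `]alpha, beta[ <= energy s v `]alpha, beta[)%E.

Fixpoint iderive (R : realType) (V W : normedModType R) (vs : seq V)
  (f : V -> W) : V -> W :=
  match vs with
  | [::] => f
  | v :: vs' => fun x => 'D_v (iderive vs' f) x
  end.

Definition smooth (R : realType) (V W : normedModType R) (f : V -> W) : Prop :=
  (forall vs : seq V, continuous (iderive vs f)) /\
  (forall (vs : seq V) (v x : V), derivable (iderive vs f) x v).

(* smooth embedded submanifold of R^d (without boundary): locally a regular
   level set of a smooth submersion to R^m (m = codimension) *)
Definition smooth_submanifold (R : realType) (d : nat) (N : set 'rV[R]_d)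
  : Prop :=
  exists m : nat, forall p, N p ->
    exists (U : set 'rV[R]_d) (F : 'rV[R]_d -> 'rV[R]_m),
      [/\ open U, U p, smooth F,
          N `&` U = F @^-1` [set 0] `&` U &
          forall x, (N `&` U) x -> forall w : 'rV[R]_m, exists v, 'D_v F x = w].

(* Main.v *)
(* For [s < 1/2] the kernel [|x - y|^(-1-2s)] is integrable on [I * (R \ I)] for
   every bounded interval [I], so [N]-valued maps can be glued sharply: if [v] is
   a competitor for [u], the map equal to [v] on [I] and to [u_n] off [I] is a
   competitor for [u_n].  Along a subsequence converging a.e., minimality
   of [u_n] bounds the interior energy of [u_n] on [I * I] by that of [v] plus
   interaction terms over [I * (R \ I)], which converge by dominated convergence.  With Fatou's lemma this gives the
   minimality of [u]; taking [v = u] it gives convergence of the interior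
   energies, which Fatou's lemma upgrades to strong convergence.  Every
   subsequence having such a further subsequence, the whole sequence converges. *)

Require Import Defs.
From HB Require Import structures.
From mathcomp Require Import all_boot all_order all_algebra.
From mathcomp Require Import all_classical all_reals all_analysis.
From mathcomp Require Import measurable_realfun ring lra.
Import Order.TTheory GRing.Theory Num.Theory.
Import numFieldNormedType.Exports.
Local Open Scope classical_set_scope.
Local Open Scope ring_scope.

(** * Power integrals on the line *)

(** Lebesgue measure is its own push-forward under a translation, by uniqueness from its values on
    half-open intervals. *)
Lemma ge0_integral_shift (R : realType) (a : R) (f : R -> \bar R) :
  measurable_fun setT f -> (forall x, 0 <= f x)%E ->
  (\int[lebesgue_measure]_x f (x + a)%R = \int[lebesgue_measure]_x f x)%E.
Proof.
move=> mf f0.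
pose shift : measurableTypeR R -> measurableTypeR R := fun x : R => x + a.
have mshift : measurable_fun setT shift by exact: measurable_funD.
transitivity (\int[pushforward lebesgue_measure shift]_x f x)%E.
  by rewrite ge0_integral_pushforward.
apply: eq_measure_integral => //= A mA _.
apply/esym/lebesgue_measure_unique => //= _ [[b c]] _ <-.
rewrite /pushforward.
rewrite (_ : _ @^-1` _ = `]b - a, c - a]%classic).
  rewrite !lebesgue_measure_itv/= !lte_fin.
  by rewrite ltrD2r -!EFinB (_ : c - a - (b - a) = c - b)//; ring.
by apply/seteqP; split => x /=; rewrite !in_itv/= ltrBlDr lerBrDr.
Qed.

Lemma ge0_integral_opp (R : realType) (f : R -> \bar R) :
  measurable_fun setT f -> (forall x, 0 <= f x)%E ->
  (\int[lebesgue_measure]_x f (- x)%R = \int[lebesgue_measure]_x f x)%E.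
Proof.
move=> mf f0.
transitivity (\int[pushforward lebesgue_measure
    (-%R : measurableTypeR R -> measurableTypeR R)]_x f x)%E.
  by rewrite ge0_integral_pushforward.
by apply: eq_measure_integral => //= A mA _; exact: lebesgue_measureN.
Qed.

Lemma powR_cvg_pinfty (R : realType) (p : R) : p < 0 ->
  powR x p @[x --> +oo] --> (0 : R).
Proof.
move=> p0; apply/cvgrPdist_lt => e e0; near=> x.
(* The threshold is [e] to the power [1 / p]: since [p < 0], any larger [x] has [powR x p < e]. *)
have M0 : 0 < powR e p^-1 by rewrite powR_gt0.
have Mx : powR e p^-1 < x by near: x; exact: nbhs_pinfty_gt.
have x0 : 0 < x by rewrite (lt_trans M0).
rewrite sub0r normrN ger0_norm ?powR_ge0//.
rewrite -[ltRHS]powRr1 ?(ltW e0)// -(@mulVf _ p) ?lt_eqF// powRrM.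
rewrite -[p]opprK !(powRN _ (- p)) ltf_pV2 ?posrE ?powR_gt0//.
by rewrite gt0_ltr_powR ?oppr_gt0 ?nnegrE ?opprK// ltW.
Unshelve. all: by end_near. Qed.

Lemma powR_continuous_gt0 (R : realType) (p x : R) : 0 < x ->
  {for x, continuous (fun t : R => powR t p)}.
Proof.
move=> x0; apply: differentiable_continuous; apply/derivable1_diffP.
by apply: derivable_powR; rewrite in_itv/= x0.
Qed.

Lemma derive1_powR_primitive (R : realType) (p x : R) : p != 0 -> 0 < x ->
  derivable (fun t : R => powR t p / p) x 1 /\
  derive1 (fun t : R => powR t p / p) x = powR x (p - 1).
Proof.
move=> p0 x0; have dx : is_derive x 1 (fun t : R => powR t p) (p * powR x (p - 1)).
  exact: is_derive1_powR.
have -> : (fun t : R => powR t p / p) = p^-1 \*: (fun t : R => powR t p).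
  by apply/funext => t; rewrite /= mulrC.
split; first exact: ex_derive.
by rewrite derive1E deriveZ//= derive_val; rewrite /GRing.scale/= mulKf.
Qed.

(** Fundamental theorem of calculus on a half-line with primitive [t^p / p], which vanishes at
    infinity because [p < 0]. *)
Lemma integral_powR_pinfty (R : realType) (p c : R) : p < 0 -> 0 < c ->
  (\int[lebesgue_measure]_(t in `[c, +oo[) (powR t (p - 1))%:E
    = (powR c p / - p)%:E)%E.
Proof.
move=> p0 c0.
rewrite (@ge0_continuous_FTC2y _ _ (fun t => powR t p / p) _ 0).
- by rewrite -EFinB sub0r invrN mulrN.
- by move=> x _; exact: powR_ge0.
- apply/continuous_within_itvcyP; split.
    by move=> x; rewrite in_itv/= andbT => cx; apply: powR_continuous_gt0; exact: lt_trans cx.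
  by apply: cvg_at_right_filter; exact: powR_continuous_gt0.
- rewrite -(mul0r p^-1); apply: cvgMr_tmp; exact: powR_cvg_pinfty.
- move=> x cx; have [] // := @derive1_powR_primitive R p x.
    by rewrite lt_eqF.
  exact: lt_trans cx.
- apply: cvg_at_right_filter; apply: cvgMr_tmp; exact: powR_continuous_gt0.
- move=> x; rewrite in_itv/= andbT => cx.
  have [] // := @derive1_powR_primitive R p x; first by rewrite lt_eqF.
  exact: lt_trans cx.
Qed.

(** The integrand may blow up at 0, so the interval is exhausted by [[1/(n+1), c[]. On each piece
    the primitive [t^p / p] bounds the integral by [c^p / p], and monotone convergence concludes. *)
Lemma integral_powR0_lty (R : realType) (p c : R) : 0 < p -> 0 < c ->
  (\int[lebesgue_measure]_(t in `]0%R, c[) (powR t (p - 1))%:E < +oo)%E.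
Proof.
move=> p0 c0.
rewrite itv_open_bnd_bigcup.
set F := fun n => _.
have mp D : measurable_fun D (fun t : R => (powR t (p - 1))%:E).
  by apply/measurable_EFinP; apply: measurable_funTS; exact: measurable_powR.
have ndF : nondecreasing_seq F.
  move=> m n mn; apply/subsetPset => x; rewrite /F/= !in_itv/= !add0r => /andP[mx ->].
  rewrite andbT (le_trans _ mx)// lef_pV2 ?posrE//.
  by rewrite ler_nat.
have mF n : measurable (F n) by exact: measurable_itv.
have F0 n (x : R) : F n x -> (0 <= (powR x (p - 1))%:E)%E.
  by move=> _; rewrite lee_fin powR_ge0.
have := @ge0_nondecreasing_set_cvg_integral _ (measurableTypeR R) R F
  (fun t => (powR t (p - 1))%:E) lebesgue_measure ndF mF (fun=> mp _) F0.
move=> /cvg_lim => /(_ (@ereal_hausdorff R)) <-.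
apply: (@le_lt_trans _ _ (powR c p / p)%:E); last exact: ltry.
apply: lime_le.
  apply: ereal_nondecreasing_is_cvgn.
  exact: (@ge0_nondecreasing_set_nondecreasing_integral _ (measurableTypeR R) R F _
    lebesgue_measure ndF mF (fun=> mp _) F0).
apply: nearW => n; have [cn|nc] := leP c (0 + n.+1%:R^-1).
  rewrite /F set_itv_ge ?integral_set0 ?lee_fin ?divr_ge0 ?powR_ge0 ?ltW//.
  by rewrite bnd_simp -leNgt.
rewrite add0r in nc.
have n0 : 0 < n.+1%:R^-1 :> R by [].
rewrite /F add0r integral_itv_bndo_bndc//.
rewrite (@continuous_FTC2 _ _ (fun t => powR t p / p))//.
- by rewrite -EFinB lee_fin gerBl divr_ge0 ?powR_ge0 ?ltW.
- apply: continuous_in_subspaceT => x; rewrite inE/= in_itv/= => /andP[nx _].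
  by apply: powR_continuous_gt0; exact: lt_le_trans nx.
- split.
  + move=> x; rewrite in_itv/= => /andP[nx _].
    have [] // := @derive1_powR_primitive R p x; first by rewrite gt_eqF.
    exact: lt_trans nx.
  + apply: cvg_at_right_filter; apply: cvgMr_tmp; exact: powR_continuous_gt0.
  + apply: cvg_at_left_filter; apply: cvgMr_tmp; exact: powR_continuous_gt0.
- move=> x; rewrite in_itv/= => /andP[nx _].
  have [] // := @derive1_powR_primitive R p x; first by rewrite gt_eqF.
  exact: lt_trans nx.
Qed.

(** * Integrability of the kernel off the diagonal *)

(** Finiteness has to be shown along with positivity, because [fine] sends [+oo] to 0. The integral
    is cut at 1: near 0 it is compared with [t^(x-1)], beyond 1 with the exponential density. *)
Lemma Gamma_gt0_unit (R : realType) (x : R) : 0 < x -> x < 1 -> 0 < Gamma x.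
Proof.
move=> x0 x1; set f := fun t : R => (powR t (x - 1) * expR (- t))%:E.
have f0 t : (0 <= f t)%E by rewrite lee_fin mulr_ge0 ?powR_ge0 ?expR_ge0.
have mpow (D : set R) : measurable_fun D (fun t : R => (powR t (x - 1))%:E).
  by apply/measurable_EFinP; apply: measurable_funTS; exact: measurable_powR.
have mf (D : set R) : measurable_fun D f.
  apply/measurable_EFinP/measurable_funTS; apply: measurable_funM => //.
  by apply: measurableT_comp => //; exact: oppr_measurable.
have splitE : `]0, +oo[%classic = `]0, 1[ `|` `[1, +oo[ :> set R.
  by rewrite -itv_bndbnd_setU ?bnd_simp.
have disj : [disjoint `]0, 1[%classic & `[1, +oo[%classic : set R].
  apply/eqP/seteqP; split => // t /=; rewrite !in_itv/= andbT => -[/andP[_ t1]].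
  by rewrite leNgt t1.
have E : (\int[lebesgue_measure]_(t in `]0%R, +oo[%classic) f t =
    \int[lebesgue_measure]_(t in `]0%R, 1%R[%classic) f t +
    \int[lebesgue_measure]_(t in `[1%R, +oo[%classic) f t)%E.
  by rewrite splitE ge0_integral_setU//; exact: mf.
have near0 : (\int[lebesgue_measure]_(t in `]0%R, 1%R[%classic) f t < +oo)%E.
  apply: le_lt_trans (@integral_powR0_lty R x 1 x0 ltr01).
  apply: ge0_le_integral => //=; [exact: mf|exact: mpow|move=> t].
  rewrite in_itv/= => /andP[t0 _].
  rewrite lee_fin ler_piMr ?powR_ge0// -expR0 ler_expR oppr_le0 ltW//.
have far : (\int[lebesgue_measure]_(t in `[1%R, +oo[%classic) f t < +oo)%E.
  apply: (@le_lt_trans _ _ (\int[lebesgue_measure]_(t in `[1%R, +oo[%classic)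
      (exponential_pdf 1 t)%:E)%E).
    apply: ge0_le_integral => //=.
    - exact: mf.
    - apply/measurable_EFinP/measurable_funTS; exact: measurable_exponential_pdf.
    - move=> t; rewrite in_itv/= andbT => t1.
      rewrite exponential_pdfE; last exact: le_trans t1.
      rewrite mul1r mulN1r lee_fin ler_piMl ?expR_ge0//.
      by rewrite -[leRHS](powRr0 t) ler_powR//; lra.
  apply: (@le_lt_trans _ _ (\int[lebesgue_measure]_t (exponential_pdf 1 t)%:E)%E).
    apply: ge0_subset_integral => //.
    - apply/measurable_EFinP; exact: measurable_exponential_pdf.
    - by move=> t _; rewrite lee_fin exponential_pdf_ge0.
  by rewrite integral_exponential_pdf// ltry.
(* On []0, 1[] both [t^(x-1) >= 1] and [e^(-t) >= e^(-1)]. *)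
have lo : ((expR (- 1))%:E <= \int[lebesgue_measure]_(t in `]0%R, 1%R[%classic) f t)%E.
  apply: (@le_trans _ _ (\int[lebesgue_measure]_(t in `]0%R, 1%R[%classic)
      (expR (- 1))%:E)%E).
    by rewrite integral_cst//= lebesgue_measure_itv/= lte_fin ltr01 sube0 mule1.
  apply: ge0_le_integral => //=.
  - exact: mf.
  - move=> t; rewrite in_itv/= => /andP[t0 t1].
    rewrite lee_fin; apply: (@le_trans _ _ (1 * expR (- t))).
      by rewrite mul1r ler_expR lerN2 ltW.
    rewrite ler_wpM2r ?expR_ge0// -[leLHS](powRr0 t) ger_powR ?t0 ?ltW//.
    by rewrite subr_lt0.
rewrite /Gamma -/f E fine_gt0//; apply/andP; split.
  apply: lt_le_trans (leeDl _ _); last exact: integral_ge0.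
  by apply: lt_le_trans lo; rewrite lte_fin expR_gt0.
by rewrite lte_add_pinfty.
Qed.

(** For [0 < s < 1/2] both arguments of Gamma, [(1 + 2s)/2] and [1 - s], lie in []0, 1[]. *)
Lemma gamma_s_gt0 (R : realType) (s : R) : 0 < s -> s < 2^-1 -> 0 < gamma_s s.
Proof.
move=> s0 s1; rewrite /gamma_s divr_gt0 ?mulr_gt0 ?powR_gt0 ?pi_gt0//.
  by apply: Gamma_gt0_unit; lra.
by apply: Gamma_gt0_unit; lra.
Qed.

(** The singular weight of [skernel] without the squared difference; for bounded maps, integrability
    of [skernel] off the diagonal reduces to that of this weight. *)
Definition fkernel {R : realType} (s : R) (z : R * R) : R :=
  (powR `|z.1 - z.2| (1 + 2 * s))^-1.

Lemma fkernel_ge0 {R : realType} (s : R) (z : R * R) : 0 <= fkernel s z.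
Proof. by rewrite /fkernel invr_ge0 powR_ge0. Qed.

Lemma fkernelE {R : realType} (s : R) (z : R * R) :
  fkernel s z = powR `|z.1 - z.2| (- (2 * s) - 1).
Proof. by rewrite /fkernel -powRN; congr powR; ring. Qed.

Lemma measurable_fkernel {R : realType} (s : R) : measurable_fun setT (fkernel s).
Proof.
rewrite (funext (fkernelE s)).
apply: (@measurableT_comp _ _ _ _ _ _ (fun t : R => powR t (- (2 * s) - 1)) _
  (fun z : R * R => `|z.1 - z.2|)); first exact: measurable_powR.
apply: (@measurableT_comp _ _ _ _ _ _ (@Num.norm R R) _ (fun z : R * R => z.1 - z.2)).
  exact: normr_measurable.
by apply: measurable_funB; [exact: measurable_fst|exact: measurable_snd].
Qed.

(** By Tonelli, integrating in [y] outside []a, b[] leaves [((x-a)^(-2s) + (b-x)^(-2s)) / (2s)],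
    which is integrable on []a, b[] because [2s < 1]. *)
Lemma fkernel_exterior_lty {R : realType} (s a b : R) : 0 < s -> s < 2^-1 -> a < b ->
  (\int[@leb2 R]_(z in `]a, b[ `*` ~` `]a, b[) (fkernel s z)%:E < +oo)%E.
Proof.
move=> s0 s1 ab; rewrite /leb2.
set D := `]a, b[ `*` ~` `]a, b[.
have mD : measurable D by apply: measurableX => //; exact: measurableC.
have mk : measurable_fun setT (fun z : R * R => (fkernel s z)%:E).
  by apply/measurable_EFinP; exact: measurable_fkernel.
have mkD : measurable_fun setT ((fun z : R * R => (fkernel s z)%:E) \_ D).
  by apply/(measurable_restrictT _ mD); exact: measurable_funTS.
rewrite integral_mkcond fubini_tonelli1//; last first.
  by move=> z; apply: erestrict_ge0 => z' _; rewrite lee_fin fkernel_ge0.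
(* [tail c] is the kernel as a function of a one-sided distance, restricted to distances at least
   [c]. *)
pose tail c : R -> \bar R := (fun t => (powR t (- (2 * s) - 1))%:E) \_ `[c, +oo[.
have tail0 c t : (0 <= tail c t)%E.
  by apply: erestrict_ge0 => t' _; rewrite lee_fin powR_ge0.
have mtail c : measurable_fun setT (tail c).
  apply/(measurable_restrictT _ (measurable_itv _)).
  by apply/measurable_EFinP/measurable_funTS; exact: measurable_powR.
have itail c : 0 < c ->
    (\int[lebesgue_measure]_t tail c t = (powR c (- (2 * s)) / (2 * s))%:E)%E.
  move=> c0; rewrite /tail -integral_mkcond integral_powR_pinfty ?opprK//.
  by rewrite oppr_lt0; lra.
(* [near] is, up to the factor [1 / (2s)], the inner integral as a function of the distance from [x]
   to one endpoint. *)
pose near : R -> \bar R := (fun t => (powR t (- (2 * s)))%:E) \_ `]0%R, (b - a)%R[.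
have near0 t : (0 <= near t)%E.
  by apply: erestrict_ge0 => t' _; rewrite lee_fin powR_ge0.
have mnear : measurable_fun setT near.
  apply/(measurable_restrictT _ (measurable_itv _)).
  by apply/measurable_EFinP/measurable_funTS; exact: measurable_powR.
have inear : (\int[lebesgue_measure]_t near t < +oo)%E.
  rewrite /near -integral_mkcond (_ : - (2 * s) = 1 - 2 * s - 1); last by ring.
  by apply: integral_powR0_lty; lra.
have mnearN : measurable_fun setT (fun t : R => near (- t)).
  by apply: (measurableT_comp mnear); exact: oppr_measurable.
have mtailN c : measurable_fun setT (fun t : R => tail c (- t)).
  by apply: (measurableT_comp (mtail c)); exact: oppr_measurable.
have mshift (f : R -> \bar R) (c : R) : measurable_fun setT f ->
    measurable_fun setT (fun t : R => f (t + c)).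
  by move=> mf; apply: (measurableT_comp mf); exact: measurable_funD.
pose q := (2 * s)^-1.
have q0 : 0 <= q by rewrite invr_ge0; lra.
apply: (@le_lt_trans _ _
  (\int[lebesgue_measure]_x (q%:E * (near (x - a) + near (- (x - b)))%R))%E).
  apply: ge0_le_integral => //=.
  - by move=> x _; apply: integral_ge0 => y _; apply: erestrict_ge0 => z' _;
      rewrite lee_fin fkernel_ge0.
  - apply: (@measurable_fun_fubini_tonelli_F _ _ (measurableTypeR R) (measurableTypeR R)).
      exact: mkD.
    by move=> z; apply: erestrict_ge0 => z' _; rewrite lee_fin fkernel_ge0.
  - apply: measurable_funeM; apply: emeasurable_funD; first exact: mshift.
    exact: (mshift (fun t : R => near (- t))).
  move=> x _; rewrite /fubini_F; have [xab|xab] := boolP (x \in `]a, b[); last first.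
    rewrite integral0_eq ?mule_ge0 ?adde_ge0//.
    move=> y _; rewrite patchE ifF//; apply/negbTE/negP; rewrite inE => -[/=].
    by rewrite (negbTE xab).
  have := xab; rewrite in_itv/= => /andP[ax xb].
  (* A point [y] outside []a, b[] lies at distance at least [x - a] to the left of [x] or at least
     [b - x] to its right, so two tails dominate the kernel. *)
  apply: (@le_trans _ _ (\int[lebesgue_measure]_y
      (tail (b - x)%R (y - x)%R + tail (x - a)%R (- (y - x))%R))%E).
    apply: ge0_le_integral => //=.
    - by move=> y _; apply: erestrict_ge0 => z' _; rewrite lee_fin fkernel_ge0.
    - by apply: (measurableT_comp mkD); exact: measurable_pair1.
    - apply: emeasurable_funD; first exact: mshift.
      exact: (mshift (fun t : R => tail (x - a) (- t))).
    move=> y _; rewrite patchE; case: ifPn => [|_]; last by rewrite adde_ge0.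
    move=> /set_mem[_ /negP] /=; rewrite in_itv/= negb_and -!leNgt fkernelE/=.
    move=> /orP[ya|yb].
      rewrite (_ : tail (x - a) _ = (powR (x - y) (- (2 * s) - 1))%:E); last first.
        by rewrite /tail patchE opprB ifT// inE/= in_itv/= andbT lerB.
      rewrite ger0_norm; last lra.
      by rewrite leeDr.
    rewrite (_ : tail (b - x) _ = (powR (y - x) (- (2 * s) - 1))%:E); last first.
      by rewrite /tail patchE ifT// inE/= in_itv/= andbT lerB.
    rewrite distrC ger0_norm; last lra.
    by rewrite leeDl.
  rewrite ge0_integralD//; last 2 first.
  - exact: mshift.
  - exact: (mshift (fun t : R => tail (x - a) (- t))).
  rewrite (@ge0_integral_shift _ (- x) (tail (b - x)))//.
  rewrite (@ge0_integral_shift _ (- x) (fun t => tail (x - a) (- t)%R))//.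
  rewrite ge0_integral_opp// !itail ?subr_gt0//.
  rewrite /near !patchE !ifT; last 2 first.
  - by rewrite inE/= in_itv/=; lra.
  - by rewrite inE/= in_itv/=; lra.
  rewrite opprB -!EFinD -EFinM lee_fin -/q.
  by rewrite -mulrDl mulrC addrC.
rewrite ge0_integralZl//=; last 2 first.
- apply: emeasurable_funD; first exact: mshift.
  exact: (mshift (fun t : R => near (- t))).
- by move=> x _; rewrite adde_ge0.
rewrite ge0_integralD//; last 2 first.
- exact: mshift.
- exact: (mshift (fun t : R => near (- t))).
rewrite (@ge0_integral_shift _ (- a) near)//.
rewrite (@ge0_integral_shift _ (- b) (fun t => near (- t)%R))//.
rewrite ge0_integral_opp//; apply: lte_mul_pinfty => //.
exact: (lte_add_pinfty inear).
Qed.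

(** * Limits of integrals *)

Section measure_limits.
Context {d : measure_display} {T : measurableType d} {R : realType}.
Variable mu : {measure set T -> \bar R}.
Local Open Scope ereal_scope.

Lemma einfs_le_seq (x : (\bar R)^nat) n : einfs x n <= x n.
Proof. by apply: ereal_inf_lbound; exists n => /=. Qed.

Lemma limn_einf_le_cvg (x y : (\bar R)^nat) (l : \bar R) :
  (forall n, x n <= y n) -> y @ \oo --> l -> limn_einf x <= l.
Proof.
move=> xy yl; rewrite limn_einf_lim -(cvg_lim _ yl)//.
apply: lee_lim; first exact: is_cvg_einfs.
  by apply/cvg_ex; exists l.
by apply: nearW => n; apply: le_trans (xy n); exact: einfs_le_seq.
Qed.

(** The sequence [x] is squeezed between its lower envelopes [einfs x] and [y], and both tend to
    [l]. *)
Lemma cvg_of_limn_einf_ge (x y : (\bar R)^nat) (l : \bar R) :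
  l <= limn_einf x -> (forall n, x n <= y n) -> y @ \oo --> l -> x @ \oo --> l.
Proof.
move=> lx xy yl.
have lE : limn_einf x = l.
  by apply/eqP; rewrite eq_le lx andbT; exact: limn_einf_le_cvg yl.
apply: (@squeeze_cvge _ _ _ _ (einfs x) x y) => //.
  by apply: nearW => n; rewrite einfs_le_seq xy.
by rewrite -lE limn_einf_lim; exact: is_cvg_einfs.
Qed.

Variables (D : set T) (f_ : (T -> \bar R)^nat) (f : T -> \bar R).
Hypotheses (mD : measurable D) (mf_ : forall n, measurable_fun D (f_ n)).
Hypotheses (mf : measurable_fun D f).
Hypotheses (f_0 : forall n x, D x -> 0 <= f_ n x) (f0 : forall x, D x -> 0 <= f x).
Hypothesis f_f : {ae mu, forall x, D x -> f_ ^~ x @ \oo --> f x}.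

(** Off a null set [f] equals the pointwise lower limit, to which the usual Fatou lemma applies. *)
Lemma fatou_ae :
  \int[mu]_(x in D) f x <= limn_einf (fun n => \int[mu]_(x in D) f_ n x).
Proof.
apply: le_trans (fatou mu mD mf_ f_0).
apply: ae_ge0_le_integral => //.
- move=> x Dx; rewrite limn_einf_lim; apply: lime_ge; first exact: is_cvg_einfs.
  apply: nearW => n; apply: le_ereal_inf_tmp => _ [m _ <-]; exact: f_0.
- rewrite /limn_einf; apply: measurableT_comp => //.
  by apply: measurable_fun_limn_esup => n; exact: measurableT_comp.
by apply: filterS f_f => x fx Dx; rewrite (cvg_limn_einf_sup (fx Dx)).1.
Qed.

(** This is the form in which Fatou's lemma gives convergence of energies: it supplies the lower
    bound, minimality will supply the upper bounds [y]. *)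
Lemma fatou_squeeze (y : (\bar R)^nat) :
  (forall n, \int[mu]_(x in D) f_ n x <= y n) ->
  y @ \oo --> \int[mu]_(x in D) f x ->
  \int[mu]_(x in D) f_ n x @[n --> \oo] --> \int[mu]_(x in D) f x.
Proof. by move=> fy yf; apply: (cvg_of_limn_einf_ge _ _ _ fatou_ae fy yf). Qed.

Lemma fatou_le (y : (\bar R)^nat) (l : \bar R) :
  (forall n, \int[mu]_(x in D) f_ n x <= y n) -> y @ \oo --> l ->
  \int[mu]_(x in D) f x <= l.
Proof. by move=> fy yl; apply: le_trans fatou_ae _; exact: limn_einf_le_cvg yl. Qed.

End measure_limits.

#[local] Instance ae_lebesgue_filter {R : realType} :
  Filter (nbhs (almost_everywhere (@lebesgue_measure R))).
Proof. exact: (@ae_filter_ringOfSetsType _ (measurableTypeR R) R lebesgue_measure). Qed.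

(** * Null sets and symmetry in the plane *)

Section lebesgue_plane.
Context {R : realType}.
Local Notation mu := (@lebesgue_measure R).

(** If [P] fails only on a null set [A], then [Q] can fail only on [A * R] or [R * A], both null for
    the product measure. *)
Lemma ae_leb2 (P : R -> Prop) (Q : R * R -> Prop) :
  (forall z, P z.1 -> P z.2 -> Q z) ->
  {ae mu, forall x, P x} -> {ae (mu \x mu)%E, forall z, Q z}.
Proof.
move=> PQ [A [mA A0 PA]].
exists ((A `*` setT) `|` (setT `*` A)); split.
- by apply: measurableU; exact: measurableX.
- have mT : measurable (setT : set (measurableTypeR R)) by [].
  have AT0 : (mu \x mu)%E (A `*` setT) = 0%E
    by rewrite product_measure1E// [X in (X * _)%E](_ : _ = 0%E) ?mul0e.
  have TA0 : (mu \x mu)%E (setT `*` A) = 0%E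
    by rewrite product_measure1E// [X in (_ * X)%E](_ : _ = 0%E) ?mule0.
  apply/negligibleP; first by apply: measurableU; exact: measurableX.
  by apply: negligibleU; apply/negligibleP => //; exact: measurableX.
- move=> z /= nQz; have [Pz1|] := pselect (P z.1); last first.
    by move=> nPz1; left; split => //; exact: PA.
  by right; split => //; apply: PA => Pz2; apply: nQz; exact: PQ.
Qed.

(** Exchanging the variables exchanges the two iterated integrals of Tonelli's theorem. *)
Lemma ge0_integral_leb2_swap (f : R * R -> \bar R) :
  measurable_fun setT f -> (forall z, 0 <= f z)%E ->
  (\int[@leb2 R]_z f z = \int[@leb2 R]_z f (z.2, z.1))%E.
Proof.
move=> mf f0; rewrite /leb2 fubini_tonelli1// fubini_tonelli2//.
by apply: measurableT_comp => //; exact: measurable_swap.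
Qed.

Lemma integral_leb2X_swap (f : R * R -> \bar R) (A B : set R) :
  measurable A -> measurable B -> measurable_fun setT f ->
  (forall z, 0 <= f z)%E -> (forall z, f (z.2, z.1) = f z) ->
  (\int[@leb2 R]_(z in A `*` B) f z = \int[@leb2 R]_(z in B `*` A) f z)%E.
Proof.
move=> mA mB mf f0 fsym.
rewrite integral_mkcond [RHS]integral_mkcond ge0_integral_leb2_swap; last 2 first.
- apply/(measurable_restrictT _ (measurableX mA mB)); exact: measurable_funTS.
- by move=> z; apply: erestrict_ge0.
apply: eq_integral => -[x y] _; rewrite !patchE /= (fsym (x, y) : f (y, x) = _).
by congr (if _ then _ else _); apply/idP/idP; rewrite !inE => -[].
Qed.

End lebesgue_plane.

(** * The squared norm and the Gagliardo kernel *)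

Section sqnorm_theory.
Context {R : realType} {d : nat}.
Implicit Types v w : 'rV[R]_d.

Lemma sqnorm_ge0 v : 0 <= sqnorm v.
Proof. by apply: sumr_ge0 => i _; exact: sqr_ge0. Qed.

Lemma sqnormB v w : sqnorm (v - w) = \sum_(i < d) (v ord0 i - w ord0 i) ^+ 2.
Proof. by apply: eq_bigr => i _; rewrite !mxE. Qed.

Lemma sqnormBC v w : sqnorm (v - w) = sqnorm (w - v).
Proof. by rewrite !sqnormB; apply: eq_bigr => i _; ring. Qed.

(** The right side minus the left is the squared norm of [v + w]. The bound serves both for
    domination and for the nonnegativity in the Brezis-Lieb argument. *)
Lemma sqnormB_le v w : sqnorm (v - w) <= 2 * sqnorm v + 2 * sqnorm w.
Proof.
rewrite sqnormB /sqnorm !mulr_sumr -big_split/=; apply: ler_sum => i _.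
rewrite -subr_ge0 (_ : _ - _ = (v ord0 i + w ord0 i) ^+ 2); last by ring.
exact: sqr_ge0.
Qed.

Lemma sqr_coord_le_sqnorm v i : v ord0 i ^+ 2 <= sqnorm v.
Proof.
rewrite /sqnorm (bigD1 i)//= lerDl.
by apply: sumr_ge0 => j _; exact: sqr_ge0.
Qed.

Lemma cvg_sqnormB (v_ w_ : nat -> 'rV[R]_d) v w :
  v_ @ \oo --> v -> w_ @ \oo --> w ->
  sqnorm (v_ n - w_ n) @[n --> \oo] --> sqnorm (v - w).
Proof.
move=> vv ww; rewrite sqnormB; under eq_fun do rewrite sqnormB.
apply: cvg_big => [|i _]; first exact: add_continuous.
rewrite expr2; under eq_fun do rewrite expr2.
have vi : v_ n ord0 i @[n --> \oo] --> v ord0 i.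
  apply: (@cvg_comp _ _ _ v_ (fun M : 'rV[R]_d => M ord0 i) _ _ _ vv).
  exact: coord_continuous.
have wi : w_ n ord0 i @[n --> \oo] --> w ord0 i.
  apply: (@cvg_comp _ _ _ w_ (fun M : 'rV[R]_d => M ord0 i) _ _ _ ww).
  exact: coord_continuous.
by apply: cvgM; exact: cvgB.
Qed.

(** The norm on row vectors is the largest absolute coordinate, and each squared coordinate is at
    most [sqnorm]. *)
Lemma cvg_of_sqnorm (v_ : nat -> 'rV[R]_d) v :
  sqnorm (v_ n - v) @[n --> \oo] --> 0 -> v_ @ \oo --> v.
Proof.
move=> /cvgrPdist_lt v0; apply/cvgrPdist_lt => e e0; near=> n.
have : `|0 - sqnorm (v_ n - v)| < e ^+ 2.
  by near: n; apply: v0; rewrite exprn_gt0.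
rewrite sub0r normrN ger0_norm ?sqnorm_ge0// => ne.
rewrite [ltLHS]/Num.Def.normr/= mx_normrE; apply/bigmax_ltP; split => // -[i j] _ /=.
rewrite ord1; set t := (v - v_ n) _ _.
have : `|t| ^+ 2 < e ^+ 2.
  rewrite -normrX ger0_norm ?sqr_ge0//; apply: le_lt_trans ne; rewrite sqnormBC.
  exact: sqr_coord_le_sqnorm.
by rewrite ltr_pXn2r ?nnegrE// ltW.
Unshelve. all: by end_near. Qed.

Lemma compact_sqnorm_bounded (N : set 'rV[R]_d) :
  compact N -> exists2 C : R, 0 <= C & forall p, N p -> sqnorm p <= C.
Proof.
move=> /compact_bounded [M [_ HM]].
(* Boundedness gives a bound by every number strictly above [M]; this one is also nonnegative. *)
pose M' := `|M| + 1.
have M'0 : 0 <= M' by rewrite addr_ge0.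
exists (\sum_(i < d) M' ^+ 2); first by apply: sumr_ge0 => i _; exact: sqr_ge0.
move=> p Np; apply: ler_sum => i _.
rewrite -[leLHS]ger0_norm ?sqr_ge0// normrX ler_pXn2r ?nnegrE//.
apply: le_trans (HM M' _ p Np); last by rewrite (le_lt_trans (ler_norm _))// ltrDl.
rewrite [leRHS]/Num.Def.normr /= mx_normrE; apply/bigmax_geP; right => /=.
by exists (ord0, i).
Qed.

(** Spelled like the measurability clause of [L2loc], so that it can be read off from membership in
    [Hhat]. *)
Definition measurable_coords (u : R -> 'rV[R]_d) :=
  forall i : 'I_d, measurable_fun setT (fun x => u x ord0 i).

Lemma measurable_sqnorm u : measurable_coords u ->
  measurable_fun setT (fun x => sqnorm (u x)).
Proof.
by move=> mu; apply: measurable_sum => i; apply: measurable_funX; exact: mu.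
Qed.

Lemma measurable_coordsB (u v : R -> 'rV[R]_d) : measurable_coords u -> measurable_coords v ->
  measurable_coords (fun x => u x - v x).
Proof.
move=> mu mv i; rewrite (_ : (fun _ => _) = fun x => u x ord0 i - v x ord0 i).
  by apply: measurable_funB; [exact: mu|exact: mv].
by apply/funext => x; rewrite !mxE.
Qed.

End sqnorm_theory.

Section skernel_theory.
Context {R : realType} {d : nat} (s : R).
Implicit Types u v w : R -> 'rV[R]_d.
Local Notation mu := (@lebesgue_measure R).

Lemma skernelE u z :
  skernel s u z = (sqnorm (u z.1 - u z.2) * fkernel s z)%:E.
Proof. by []. Qed.

Lemma skernel_ge0 u z : (0 <= skernel s u z)%E.
Proof. by rewrite skernelE lee_fin mulr_ge0 ?sqnorm_ge0 ?fkernel_ge0. Qed.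

Lemma skernel_sym u z : skernel s u (z.2, z.1) = skernel s u z.
Proof. by rewrite !skernelE/= sqnormBC /fkernel/= distrC. Qed.

Lemma measurable_skernel u : measurable_coords u ->
  measurable_fun setT (skernel s u).
Proof.
move=> mcu; apply/measurable_EFinP.
apply: (@measurable_funM _ _ _ _ (fun z => sqnorm (u z.1 - u z.2)) (fkernel s));
  last exact: measurable_fkernel.
rewrite (_ : (fun _ => _) = fun z => \sum_(i < d) (u z.1 ord0 i - u z.2 ord0 i) ^+ 2).
  apply: measurable_sum => i; apply: measurable_funX; apply: measurable_funB.
    by apply: (measurableT_comp (mcu i)); exact: measurable_fst.
  by apply: (measurableT_comp (mcu i)); exact: measurable_snd.
by apply/funext => z; rewrite sqnormB.
Qed.

Lemma skernel_cvg (u_ : nat -> R -> 'rV[R]_d) u (z : R * R) :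
  u_ ^~ z.1 @ \oo --> u z.1 -> u_ ^~ z.2 @ \oo --> u z.2 ->
  skernel s (u_ n) z @[n --> \oo] --> skernel s u z.
Proof.
move=> u1 u2; rewrite skernelE; under eq_fun do rewrite skernelE.
apply/fine_cvgP; split; first exact: nearW.
by apply: cvgMr_tmp; exact: cvg_sqnormB.
Qed.

Lemma ae_skernel_cvg (u_ : nat -> R -> 'rV[R]_d) u (D : set (R * R)) :
  {ae mu, forall x, u_ ^~ x @ \oo --> u x} ->
  {ae (mu \x mu)%E, forall z : R * R, D z ->
    skernel s (u_ n) z @[n --> \oo] --> skernel s u z}.
Proof.
by apply: ae_leb2 => z z1 z2 _; exact: skernel_cvg.
Qed.

Lemma ae_eq_integral_skernel u v (A B : set R) :
  measurable A -> measurable B -> measurable_coords u -> measurable_coords v ->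
  {ae mu, forall x, (A `|` B) x -> u x = v x} ->
  (\int[@leb2 R]_(z in A `*` B) skernel s u z =
   \int[@leb2 R]_(z in A `*` B) skernel s v z)%E.
Proof.
move=> mA mB mcu mcv uv; apply: ae_eq_integral => //.
- exact: measurableX.
- by apply: measurable_funTS; exact: measurable_skernel.
- by apply: measurable_funTS; exact: measurable_skernel.
- apply: ae_leb2 uv => z z1 z2 [/= Az Bz].
  by rewrite !skernelE z1; [rewrite z2//; right|left].
Qed.

(** A common bound [C] on the squared norms makes a multiple of [fkernel] an integrable majorant on
    [D], so dominated convergence applies. *)
Lemma skernel_dominated (D : set (R * R)) (C : R) (u_ : nat -> R -> 'rV[R]_d) u :
  measurable D -> (\int[@leb2 R]_(z in D) (fkernel s z)%:E < +oo)%E ->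
  (forall n, measurable_coords (u_ n)) -> measurable_coords u ->
  (forall n, {ae mu, forall x, sqnorm (u_ n x) <= C}) ->
  {ae mu, forall x, u_ ^~ x @ \oo --> u x} ->
  (\int[@leb2 R]_(z in D) skernel s u z < +oo)%E /\
  (\int[@leb2 R]_(z in D) skernel s (u_ n) z @[n --> \oo] -->
   \int[@leb2 R]_(z in D) skernel s u z)%E.
Proof.
move=> mD kD mu_ mcu uC uu.
(* The factor is [4 * C = 2 * C + 2 * C], from [sqnormB_le]. *)
have ik : (mu \x mu)%E.-integrable D (fun z => (4 * C)%:E * (fkernel s z)%:E)%E.
  apply: integrableZl => //; apply/integrableP; split.
    apply: measurable_funTS; apply/measurable_EFinP; exact: measurable_fkernel.
  by under eq_integral do rewrite abse_EFin ger0_norm ?fkernel_ge0//.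
have [] := @dominated_convergence _ _ _ (mu \x mu)%E D mD
  (fun n => skernel s (u_ n)) (skernel s u) _ _ _ _ ik.
- by move=> n; apply: measurable_funTS; exact: measurable_skernel.
- by apply: measurable_funTS; exact: measurable_skernel.
- exact: ae_skernel_cvg.
- move: uC => /ae_foralln; apply: ae_leb2 => z z1 z2 n _.
  rewrite gee0_abs ?skernel_ge0// skernelE -EFinM lee_fin.
  rewrite ler_wpM2r ?fkernel_ge0// (le_trans (sqnormB_le _ _))//.
  by have := z1 n; have := z2 n; lra.
move=> iu _ cu; split => //.
move/integrableP : iu => [_]; under eq_integral do rewrite gee0_abs ?skernel_ge0//.
by [].
Qed.

Lemma skernel_bounded_lty (D : set (R * R)) (C : R) u :
  measurable D -> (\int[@leb2 R]_(z in D) (fkernel s z)%:E < +oo)%E ->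
  measurable_coords u -> {ae mu, forall x, sqnorm (u x) <= C} ->
  (\int[@leb2 R]_(z in D) skernel s u z < +oo)%E.
Proof.
move=> mD kD mcu uC.
have [] // := @skernel_dominated D C (fun=> u) u mD kD _ mcu.
by apply: aeW => x; exact: cvg_cst.
Qed.

End skernel_theory.

(** * Splitting the energy *)

Section plane_splitting.
Context {R : realType} (f : R * R -> \bar R).
Hypotheses (mf : measurable_fun setT f) (f0 : forall z, (0 <= f z)%E).
Variables (A B C : set R).
Hypotheses (mA : measurable A) (mB : measurable B) (mC : measurable C).
Hypothesis AB : A `<=` B.

Lemma integral_leb2X_splitl :
  (\int[@leb2 R]_(z in B `*` C) f z =
   \int[@leb2 R]_(z in A `*` C) f z + \int[@leb2 R]_(z in (B `\` A) `*` C) f z)%E.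
Proof.
have -> : B `*` C = (A `*` C) `|` ((B `\` A) `*` C).
  apply/seteqP; split => z /=; last by move=> [[/AB]|[[]]].
  by move=> [Bz Cz]; have [Az|nAz] := pselect (A z.1); [left|right].
rewrite /leb2 ge0_integral_setU//.
- exact: measurableX.
- by apply: measurableX => //; exact: measurableD.
- exact: measurable_funTS.
- by apply/eqP/seteqP; split => // z [[/= Az _] [[_ /(_ Az)]]].
Qed.

Lemma integral_leb2X_splitr :
  (\int[@leb2 R]_(z in C `*` B) f z =
   \int[@leb2 R]_(z in C `*` A) f z + \int[@leb2 R]_(z in C `*` (B `\` A)) f z)%E.
Proof.
have -> : C `*` B = (C `*` A) `|` (C `*` (B `\` A)).
  apply/seteqP; split => z /=; last by move=> [[? /AB]|[? []]].
  by move=> [Cz Bz]; have [Az|nAz] := pselect (A z.2); [left|right].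
rewrite /leb2 ge0_integral_setU//.
- exact: measurableX.
- by apply: measurableX => //; exact: measurableD.
- exact: measurable_funTS.
- by apply/eqP/seteqP; split => // z [[/= _ Az] [_ [_ /(_ Az)]]].
Qed.

End plane_splitting.

(** The arithmetic of the energy splitting: [P], [X], [D], [E], [F] stand for the integrals over
    [I * I], [I * (W \ I)], [(W \ I) * (W \ I)], [I * ~W] and [(W \ I) * ~W]. Nonnegativity
    justifies distributivity in the extended reals. *)
Lemma ge0_muleDr_regroup {R : realType} (g : R) (P X D E F : \bar R) :
  0 <= g -> (0 <= P -> 0 <= X -> 0 <= D -> 0 <= E -> 0 <= F ->
  (g / 2)%:E * (P + X + (X + D)) + g%:E * (E + F) =
  (g / 2)%:E * P + g%:E * (E + X) + ((g / 2)%:E * D + g%:E * F))%E.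
Proof.
move=> g0 P0 X0 D0 E0 F0; rewrite !ge0_muleDr ?adde_ge0//.
have -> : (g%:E * X = (g / 2)%:E * X + (g / 2)%:E * X)%E.
  by rewrite -ge0_muleDl ?lee_fin ?divr_ge0// -EFinD -splitr.
by rewrite !addeA [LHS](ACl (1*5*2*3*4*6))/=.
Qed.

Section energy_theory.
Context {R : realType} {d : nat} (s : R).
Hypotheses (s0 : 0 < s) (s1 : s < 2^-1).
Implicit Types (u v w : R -> 'rV[R]_d) (I W : set R).
Local Notation mu := (@lebesgue_measure R).
Local Notation G u D := (\int[@leb2 R]_(z in D) skernel s u z)%E.
Local Notation gam := (gamma_s s).

Let gam0 : 0 < gam. Proof. exact: gamma_s_gt0. Qed.
Let gam_ge0 : 0 <= gam. Proof. exact: ltW. Qed.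
Let gam2 : 0 < gam / 2. Proof. by rewrite divr_gt0. Qed.
Let egam0 : (0 <= gam%:E)%E. Proof. by rewrite lee_fin ltW. Qed.
Let egam2 : (0 <= (gam / 2)%:E)%E. Proof. by rewrite lee_fin ltW. Qed.

Lemma integral_skernel_ge0 u D : (0 <= G u D)%E.
Proof. by apply: integral_ge0 => z _; exact: skernel_ge0. Qed.

(** The contribution to the energy in [W] of the pairs with no point in [I]. It is unaffected by
    changing the map on [I]. *)
Definition rest_energy u I W : \bar R :=
  ((gam / 2)%:E * G u ((W `\` I) `*` (W `\` I)) + gam%:E * G u ((W `\` I) `*` ~` W))%E.

Lemma rest_energy_ge0 u I W : (0 <= rest_energy u I W)%E.
Proof.
by apply: adde_ge0; apply: mule_ge0 => //; exact: integral_skernel_ge0.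
Qed.

(* The kernel is symmetric, so the two copies of [I * (W \ I)] in [W * W]
   count once with weight [gam] instead of twice with weight [gam / 2]. *)
Lemma energy_split u I W : measurable I -> measurable W -> I `<=` W ->
  measurable_coords u ->
  (energy s u W = ((gam / 2)%:E * G u (I `*` I) + gam%:E * G u (I `*` ~` I))
    + rest_energy u I W)%E.
Proof.
move=> mI mW IW mcu; have mk := measurable_skernel s u mcu.
have k0 := skernel_ge0 s u.
have mD : measurable (W `\` I) by exact: measurableD.
have mCI : measurable (~` I) by exact: measurableC.
have mCW : measurable (~` W) by exact: measurableC.
rewrite /energy /rest_energy.
rewrite (integral_leb2X_splitl _ mk k0 _ _ _ mI mW mW IW).
rewrite (integral_leb2X_splitr _ mk k0 _ _ _ mI mW mI IW).
rewrite (integral_leb2X_splitr _ mk k0 _ _ _ mI mW mD IW).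
rewrite (integral_leb2X_splitl _ mk k0 _ _ _ mI mW mCW IW).
rewrite (integral_leb2X_splitr _ mk k0 _ _ _ mCW mCI mI (subsetC IW)).
rewrite (_ : ~` I `\` ~` W = W `\` I); last by rewrite setDE setCK setIC -setDE.
rewrite (integral_leb2X_swap _ _ _ mD mI mk k0 (skernel_sym s u)).
by apply: ge0_muleDr_regroup => //; exact: integral_skernel_ge0.
Qed.

End energy_theory.

(** * Minimizers and gluing *)

Definition glue {R : realType} {d : nat} (I : set R) (v w : R -> 'rV[R]_d) (x : R) :=
  if x \in I then v x else w x.

Lemma measurable_coords_glue {R : realType} {d : nat} (I : set R)
    (v w : R -> 'rV[R]_d) : measurable I ->
  measurable_coords v -> measurable_coords w -> measurable_coords (glue I v w).
Proof.
move=> mI mv mw i.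
rewrite (_ : (fun _ => _) =
    fun x => v x ord0 i * \1_I x + w x ord0 i * \1_(~` I) x).
  apply: measurable_funD.
    by apply: measurable_funM; [exact: mv|exact: measurable_indic].
  apply: measurable_funM; first exact: mw.
  by apply: measurable_indic; exact: measurableC.
apply/funext => x; rewrite /glue !indicE in_setC.
by case: (x \in I) => /=; rewrite !(mulr1, mulr0, addr0, add0r).
Qed.

Section constrained_maps.
Context {R : realType} {d : nat} (s alpha beta : R) (N : set 'rV[R]_d) (C : R).
Hypotheses (s0 : 0 < s) (s1 : s < 2^-1) (ab : alpha < beta).
Hypotheses (C0 : 0 <= C) (NC : forall p, N p -> sqnorm p <= C).
Implicit Types (u v w : R -> 'rV[R]_d) (I : set R).
Local Notation mu := (@lebesgue_measure R).
Local Notation G u D := (\int[@leb2 R]_(z in D) skernel s u z)%E.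
Local Notation gam := (gamma_s s).
Local Notation W := (`]alpha, beta[%classic).
Local Notation Nvalued u := {ae mu, forall x, N (u x)}.

Let gam0 : 0 < gam. Proof. exact: gamma_s_gt0. Qed.
Let gam_ge0 : 0 <= gam. Proof. exact: ltW. Qed.
Let gam2 : 0 < gam / 2. Proof. by rewrite divr_gt0. Qed.
Let egam0 : (0 <= gam%:E)%E. Proof. by rewrite lee_fin ltW. Qed.
Let egam2 : (0 <= (gam / 2)%:E)%E. Proof. by rewrite lee_fin ltW. Qed.

Lemma Nvalued_bounded u : Nvalued u -> {ae mu, forall x, sqnorm (u x) <= C}.
Proof. by apply: filterS => x; exact: NC. Qed.

(** Boundedness of [N] reduces the claim to the bare kernel, integrable here because [s < 1/2]. *)
Lemma exterior_integral_lty u a b : a < b -> measurable_coords u -> Nvalued u ->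
  (G u (`]a, b[ `*` ~` `]a, b[) < +oo)%E.
Proof.
move=> altb mcu Nu; apply: (@skernel_bounded_lty _ _ _ _ C) => //.
- by apply: measurableX => //; exact: measurableC.
- exact: fkernel_exterior_lty.
- exact: Nvalued_bounded.
Qed.

Lemma Nvalued_L2loc u : measurable_coords u -> Nvalued u -> L2loc u.
Proof.
move=> mcu Nu.
split=> // a b.
apply: (@le_lt_trans _ _ (\int[mu]_(x in `[a, b]) (cst C%:E x))%E).
  apply: ae_ge0_le_integral => //.
  - by move=> x _; rewrite lee_fin sqnorm_ge0.
  - by apply: measurable_funTS; apply/measurable_EFinP; exact: measurable_sqnorm.
  - by apply: filterS (Nvalued_bounded _ Nu) => x Cx _; rewrite lee_fin.
rewrite integral_cst//= lebesgue_measure_itv/=; case: ifP => _; last by rewrite mule0 ltry.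
by rewrite -EFinB -EFinM ltry.
Qed.

(** The exterior part of the energy is automatically finite for bounded maps, so only the interior
    part needs control. *)
Lemma HhatN_intro u : measurable_coords u -> Nvalued u ->
  (G u (W `*` W) < +oo)%E -> HhatN s W N u.
Proof.
move=> mcu Nu Gu; split=> //; split; first exact: Nvalued_L2loc.
have Gext := exterior_integral_lty _ _ _ ab mcu Nu.
rewrite /energy; apply: lte_add_pinfty; apply: lte_mul_pinfty => //.
Qed.

Lemma interior_le_energy u (D : set R) :
  ((gam / 2)%:E * G u (D `*` D) <= energy s u D)%E.
Proof. by rewrite /energy leeDl// mule_ge0// integral_skernel_ge0. Qed.

Lemma HhatN_interior_lty u : HhatN s W N u -> (G u (W `*` W) < +oo)%E.
Proof.
move=> [[_ Eu] _]; rewrite ltey; apply/eqP => Goo.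
have := le_lt_trans (interior_le_energy u W) Eu.
by rewrite Goo gt0_muley ?lte_fin// ltxx.
Qed.

Lemma HhatN_subinterval_lty u I : measurable I -> I `<=` W -> HhatN s W N u ->
  (G u (I `*` I) < +oo)%E.
Proof.
move=> mI IW Hu; apply: le_lt_trans (HhatN_interior_lty _ Hu).
have [[mcu _] _] := Hu.1.
apply: ge0_subset_integral.
- exact: measurableX.
- by apply: measurableX.
- by apply: measurable_funTS; exact: measurable_skernel.
- by move=> z _; exact: skernel_ge0.
- by apply: setSX.
Qed.

(** Closedness of [N] keeps the almost everywhere limit in [N], and Fatou's lemma passes the
    interior energy bound to it. *)
Lemma HhatN_limit (u_ : nat -> R -> 'rV[R]_d) u (M : R) :
  closed N -> (forall n, HhatN s W N (u_ n)) ->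
  (forall n, (energy s (u_ n) W <= M%:E)%E) -> measurable_coords u ->
  {ae mu, forall x, u_ ^~ x @ \oo --> u x} -> HhatN s W N u.
Proof.
move=> clN Hu EM mcu uu.
have mcu_ n : measurable_coords (u_ n) by have [[[]]] := Hu n.
apply: HhatN_intro => //.
  have Nu : {ae mu, forall x, forall n, N (u_ n x)}.
    by apply/ae_foralln => n; have [] := Hu n.
  apply: filterS2 Nu uu => x Nx ux.
  by apply: (closed_cvg _ clN _ _ ux); exact: nearW.
have mWW : measurable (W `*` W) by exact: measurableX.
apply: (@le_lt_trans _ _ ((gam / 2)^-1 * M)%:E); last exact: ltry.
apply: (@fatou_le _ _ _ (mu \x mu)%E (W `*` W)
  (fun n => skernel s (u_ n)) _ mWW _ _ _ _ _ (fun=> ((gam / 2)^-1 * M)%:E)).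
- by move=> n; apply: measurable_funTS; exact: measurable_skernel.
- by apply: measurable_funTS; exact: measurable_skernel.
- by move=> n z _; exact: skernel_ge0.
- by move=> z _; exact: skernel_ge0.
- exact: ae_skernel_cvg.
- move=> n; rewrite EFinM lee_pdivlMl//.
  by apply: le_trans (EM n); exact: interior_le_energy.
- exact: cvg_cst.
Qed.

Lemma Nvalued_glue I v w : Nvalued v -> Nvalued w -> Nvalued (glue I v w).
Proof. by apply: filterS2 => x Nv Nw; rewrite /glue; case: ifP. Qed.

Lemma skernel_glue_in I v w (z : R * R) : I z.1 -> I z.2 ->
  skernel s (glue I v w) z = skernel s v z.
Proof. by move=> z1 z2; rewrite !skernelE /glue !mem_set. Qed.

Lemma skernel_glue_out I v w (z : R * R) : ~ I z.1 -> ~ I z.2 ->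
  skernel s (glue I v w) z = skernel s w z.
Proof. by move=> z1 z2; rewrite !skernelE /glue !memNset. Qed.

Lemma rest_energy_glue I v w : I `<=` W ->
  rest_energy s (glue I v w) I W = rest_energy s w I W.
Proof.
move=> IW; rewrite /rest_energy; congr (_ * _ + _ * _)%E; apply: eq_integral => z.
  by move=> /set_mem[/= [_ z1] [_ z2]]; exact: skernel_glue_out.
by move=> /set_mem[/= [_ z1] z2]; apply: skernel_glue_out => // /IW.
Qed.

Lemma rest_energy_ae_eq I u v : measurable I -> I `<=` W ->
  measurable_coords u -> measurable_coords v ->
  {ae mu, forall x, ~ I x -> u x = v x} ->
  rest_energy s u I W = rest_energy s v I W.
Proof.
move=> mI IW mcu mcv uv; have mWI : measurable (W `\` I) by exact: measurableD.
rewrite /rest_energy; congr (_ * _ + _ * _)%E; apply: ae_eq_integral_skernel => //.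
- by apply: filterS uv => x uvx [[_ /uvx]|[_ /uvx]].
- exact: measurableC.
- by apply: filterS uv => x uvx [[_ /uvx]//|nWx]; apply: uvx => /IW.
Qed.

(* Since [s < 1/2], the map equal to [v] on [I] and to [u] elsewhere is an
   admissible competitor although it may jump at the endpoints of [I]. *)
Lemma min_sharmonic_glue_le u v (a b : R) (I := `]a, b[%classic) :
  alpha < a -> a < b -> b < beta ->
  min_sharmonic s alpha beta N u -> HhatN s W N v ->
  ((gam / 2)%:E * G u (I `*` I) + gam%:E * G u (I `*` ~` I) <=
   (gam / 2)%:E * G v (I `*` I) + gam%:E * G (glue I v u) (I `*` ~` I))%E.
Proof.
move=> aa altb bb [Hu minu] Hv.
have mI : measurable I by exact: measurable_itv.
have IW : I `<=` W by apply: subset_itvW; exact: ltW.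
have [[[mcu _] Eu] Nu] := Hu; have [[[mcv _] Ev] Nv] := Hv.
have mcg := measurable_coords_glue I v u mI mcv mcu.
have Ng : Nvalued (glue I v u) by exact: Nvalued_glue.
have Gg : G (glue I v u) (I `*` I) = G v (I `*` I).
  by apply: eq_integral => z /set_mem[z1 z2]; exact: skernel_glue_in.
(* Finiteness is what allows this common term to be cancelled from the two energies at the end. *)
have rfin : rest_energy s u I W \is a fin_num.
  rewrite ge0_fin_numE ?rest_energy_ge0//; apply: le_lt_trans Eu.
  rewrite (energy_split s s0 s1 u I W)// leeDr// adde_ge0// mule_ge0//;
    exact: integral_skernel_ge0.
have splitg := energy_split s s0 s1 (glue I v u) I W mI (measurable_itv _) IW mcg.
rewrite rest_energy_glue// Gg in splitg.
(* The three parts are finite for different reasons: the interior one comes from [v], the rest from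
   [u], and the interaction across the jump from the exterior bound. *)
have Eg : (energy s (glue I v u) W < +oo)%E.
  rewrite splitg; apply: lte_add_pinfty; last by rewrite ltey_eq rfin.
  apply: lte_add_pinfty; apply: lte_mul_pinfty => //.
    exact: HhatN_subinterval_lty.
  exact: exterior_integral_lty.
have Hg : HhatN s W N (glue I v u).
  by split=> //; split=> //; exact: Nvalued_L2loc.
have : (energy s u W <= energy s (glue I v u) W)%E.
  (* The closed interval [[a, b]] lies inside []alpha, beta[] and contains every point where the
     glued map differs from [u]. *)
  apply: minu => //; exists a, b; do 2 split=> //; apply: aeW => x xab.
  rewrite /glue memNset// => xI; apply: xab; move: xI.
  by apply: subset_itvW.
by rewrite splitg (energy_split s s0 s1 u I W)// leeD2rE.
Qed.

Lemma exterior_integral_cvg (w_ : nat -> R -> 'rV[R]_d) u (a b : R) : a < b ->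
  (forall n, measurable_coords (w_ n)) -> measurable_coords u ->
  (forall n, Nvalued (w_ n)) -> {ae mu, forall x, w_ ^~ x @ \oo --> u x} ->
  (G u (`]a, b[ `*` ~` `]a, b[) < +oo)%E /\
  (G (w_ n) (`]a, b[ `*` ~` `]a, b[) @[n --> \oo] --> G u (`]a, b[ `*` ~` `]a, b[))%E.
Proof.
move=> altb mcw mcu Nw wu; apply: (@skernel_dominated _ _ _ _ C) => //.
- by apply: measurableX => //; exact: measurableC.
- exact: fkernel_exterior_lty.
- by move=> n; exact: Nvalued_bounded.
Qed.

(** * Passage to the limit along an almost everywhere convergent sequence *)

Section limit.
Variables (u_ : nat -> R -> 'rV[R]_d) (u : R -> 'rV[R]_d) (M : R).
Hypotheses (clN : closed N) (minu_ : forall n, min_sharmonic s alpha beta N (u_ n)).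
Hypotheses (EM : forall n, (energy s (u_ n) W <= M%:E)%E).
Hypotheses (mcu : measurable_coords u).
Hypothesis uu : {ae mu, forall x, u_ ^~ x @ \oo --> u x}.

Let Hu_ n : HhatN s W N (u_ n). Proof. by have [] := minu_ n. Qed.
Let mcu_ n : measurable_coords (u_ n). Proof. by have [[[]]] := Hu_ n. Qed.
Let Nu_ n : Nvalued (u_ n). Proof. by have [] := Hu_ n. Qed.
Let Hu : HhatN s W N u. Proof. exact: HhatN_limit EM mcu uu. Qed.

Section subinterval.
Variables (a b : R).
Local Notation I := (`]a, b[%classic).
Hypotheses (aa : alpha < a) (altb : a < b) (bb : b < beta).

Let mI : measurable I. Proof. exact: measurable_itv. Qed.
Let IW : I `<=` W. Proof. by apply: subset_itvW; exact: ltW. Qed.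
Let mII : measurable (I `*` I). Proof. exact: measurableX. Qed.

Let fin_interior v : HhatN s W N v -> G v (I `*` I) \is a fin_num.
Proof.
move=> Hv; rewrite ge0_fin_numE ?integral_skernel_ge0//.
exact: HhatN_subinterval_lty.
Qed.

Let fin_exterior v : HhatN s W N v -> G v (I `*` ~` I) \is a fin_num.
Proof.
move=> [[[mcv _] _] Nv]; rewrite ge0_fin_numE ?integral_skernel_ge0//.
exact: exterior_integral_lty.
Qed.

Let ext_cvg : (G (u_ n) (I `*` ~` I) @[n --> \oo] --> G u (I `*` ~` I))%E.
Proof. by have [] := exterior_integral_cvg u_ u a b altb mcu_ mcu Nu_ uu. Qed.

(** Minimality of [u_ n] against [v] glued on [I], divided by [gam / 2]; the factors 2 are the ratio
    of the weights [gam] and [gam / 2]. *)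
Lemma interior_integral_bound v : HhatN s W N v ->
  {ae mu, forall x, ~ I x -> v x = u x} ->
  exists2 y : nat -> R, (forall n, (G (u_ n) (I `*` I) <= (y n)%:E)%E) &
    y @ \oo --> fine (G v (I `*` I)) + 2 * fine (G v (I `*` ~` I))
                - 2 * fine (G u (I `*` ~` I)).
Proof.
move=> Hv vu; have [[[mcv _] _] Nv] := Hv.
pose g n := glue I v (u_ n).
have mcg n : measurable_coords (g n) by exact: measurable_coords_glue.
have Ng n : Nvalued (g n) by exact: Nvalued_glue.
(* On [I] the glued maps are constantly [v]; off [I] they are [u_ n], whose limit [u] agrees there
   with [v]. Hence their exterior integrals converge to that of [v]. *)
have gv : {ae mu, forall x, g ^~ x @ \oo --> v x}.
  apply: filterS2 uu vu => x ux vx; have [xI|xI] := pselect (I x).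
    rewrite (_ : g ^~ x = cst (v x)); first exact: cvg_cst.
    by apply/funext => n; rewrite /g /glue mem_set.
  rewrite (_ : g ^~ x = u_ ^~ x) ?vx//.
  by apply/funext => n; rewrite /g /glue memNset.
have [gfin gcvg] := exterior_integral_cvg g v a b altb mcg mcv Ng gv.
have gfin_ n : G (g n) (I `*` ~` I) \is a fin_num.
  rewrite ge0_fin_numE ?integral_skernel_ge0//; exact: exterior_integral_lty.
exists (fun n => fine (G v (I `*` I)) + 2 * fine (G (g n) (I `*` ~` I))
                 - 2 * fine (G (u_ n) (I `*` ~` I))).
  move=> n; have := min_sharmonic_glue_le _ _ _ _ aa altb bb (minu_ n) Hv.
  rewrite -/(g n) -(fineK (fin_interior _ (Hu_ n))) -(fineK (fin_exterior _ (Hu_ n))).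
  rewrite -(fineK (fin_interior _ Hv)) -(fineK (gfin_ n)) -!EFinM -!EFinD !lee_fin.
  by move=> h; rewrite -(ler_pM2l gam2) !mulrDr !mulrN; lra.
apply: cvgB; last first.
  apply: cvgMl_tmp; apply: fine_cvg; rewrite fineK//; exact: fin_exterior.
apply: cvgD; first exact: cvg_cst.
by apply: cvgMl_tmp; apply: fine_cvg; rewrite fineK// fin_exterior.
Qed.

(** Fatou's lemma bounds the interior integral of [u] by the limit of the upper bounds; multiplying
    by [gam / 2] restores the weights. *)
Lemma interior_integral_le v : HhatN s W N v ->
  {ae mu, forall x, ~ I x -> v x = u x} ->
  ((gam / 2)%:E * G u (I `*` I) + gam%:E * G u (I `*` ~` I) <=
   (gam / 2)%:E * G v (I `*` I) + gam%:E * G v (I `*` ~` I))%E.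
Proof.
move=> Hv vu; have [y uy yl] := interior_integral_bound v Hv vu.
set l := (X in _ --> X) in yl.
have : (G u (I `*` I) <= l%:E)%E.
  apply: (@fatou_le _ _ _ (mu \x mu)%E (I `*` I)
    (fun n => skernel s (u_ n)) _ mII _ _ _ _ _ (EFin \o y)) => //.
  - by move=> n; apply: measurable_funTS; exact: measurable_skernel.
  - by apply: measurable_funTS; exact: measurable_skernel.
  - by move=> n z _; exact: skernel_ge0.
  - by move=> z _; exact: skernel_ge0.
  - exact: ae_skernel_cvg.
  - by apply/fine_cvgP; split => //; exact: nearW.
rewrite -(fineK (fin_interior _ Hu)) lee_fin => h.
rewrite -(fineK (fin_exterior _ Hu)) -(fineK (fin_exterior _ Hv)) -(fineK (fin_interior _ Hv)).
rewrite -!EFinM -!EFinD lee_fin.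
by have := ler_wpM2l (ltW gam2) h; rewrite /l !mulrDr !mulrN; lra.
Qed.

(** Since [v] and [u] agree off [I], their rest energies coincide and only the terms involving [I]
    are compared. *)
Lemma energy_le_competitor v : HhatN s W N v ->
  {ae mu, forall x, ~ I x -> v x = u x} -> (energy s u W <= energy s v W)%E.
Proof.
move=> Hv vu; have [[[mcv _] _] _] := Hv.
rewrite (energy_split s s0 s1 u I W)// (energy_split s s0 s1 v I W)//.
rewrite (rest_energy_ae_eq I v u)//; apply: leeD2r.
exact: interior_integral_le.
Qed.

(** With [u] itself as competitor the exterior terms cancel in the limit, so the upper bounds tend
    to the interior integral of [u] and Fatou's lemma closes the squeeze. *)
Lemma interior_integral_cvg :
  (G (u_ n) (I `*` I) @[n --> \oo] --> G u (I `*` I))%E.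
Proof.
have [|y uy yl] := interior_integral_bound u Hu; first exact: aeW.
apply: (@fatou_squeeze _ _ _ (mu \x mu)%E (I `*` I)
    (fun n => skernel s (u_ n)) _ mII _ _ _ _ _ (EFin \o y)) => //.
- by move=> n; apply: measurable_funTS; exact: measurable_skernel.
- by apply: measurable_funTS; exact: measurable_skernel.
- by move=> n z _; exact: skernel_ge0.
- by move=> z _; exact: skernel_ge0.
- exact: ae_skernel_cvg.
- rewrite -(fineK (fin_interior _ Hu)); apply/fine_cvgP; split; first exact: nearW.
  by move: yl; rewrite addrK.
Qed.

Lemma energy_subinterval_cvg :
  energy s (u_ n) I @[n --> \oo] --> energy s u I.
Proof.
apply: cvgeD.
- by rewrite ge0_adde_def// inE mule_ge0// integral_skernel_ge0.
- by apply: cvgeZl => //; exact: interior_integral_cvg.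
- by apply: cvgeZl => //; exact: ext_cvg.
Qed.

(* Brezis-Lieb: [2 K(u_n) + 2 K(u) - K(u_n - u) >= 0] converges a.e. to [4 K(u)]. *)
Lemma gagliardo_subinterval_cvg :
  gagliardo s (fun x => u_ n x - u x) I @[n --> \oo] --> 0%E.
Proof.
pose e n := fun x => u_ n x - u x.
have mce n : measurable_coords (e n) by exact: measurable_coordsB.
have mK v : measurable_coords v -> measurable_fun (I `*` I) (skernel s v).
  by move=> mcv; apply: measurable_funTS; exact: measurable_skernel.
pose h n z := (2 * (sqnorm (u_ n z.1 - u_ n z.2) * fkernel s z)
  + 2 * (sqnorm (u z.1 - u z.2) * fkernel s z)
  - sqnorm (e n z.1 - e n z.2) * fkernel s z)%:E.
have hE n z : h n z = (2%:E * skernel s (u_ n) z + 2%:E * skernel s u z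
    - skernel s (e n) z)%E by [].
(* The increment of [e n] is the increment of [u_ n] minus that of [u], so [sqnormB_le] applies. *)
have h0 n z : (0 <= h n z)%E.
  rewrite lee_fin subr_ge0 !mulrA -mulrDl ler_wpM2r ?fkernel_ge0//.
  rewrite /e (_ : u_ n z.1 - u z.1 - (u_ n z.2 - u z.2) =
    u_ n z.1 - u_ n z.2 - (u z.1 - u z.2)); first exact: sqnormB_le.
  by rewrite !opprD !opprK addrACA.
have mh n : measurable_fun (I `*` I) (h n).
  rewrite (funext (hE n)); apply: emeasurable_funB; last exact: mK.
  by apply: emeasurable_funD; apply: measurable_funeM; exact: mK.
have twice v : measurable_coords v ->
    (\int[@leb2 R]_(z in I `*` I) (2%:E * skernel s v z) = 2%:E * G v (I `*` I))%E.
  move=> mcv; rewrite ge0_integralZl//; first exact: mK.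
  by move=> z _; exact: skernel_ge0.
pose lim z : \bar R := (2%:E * skernel s u z + 2%:E * skernel s u z)%E.
have ilim : (\int[@leb2 R]_(z in I `*` I) lim z =
    2%:E * G u (I `*` I) + 2%:E * G u (I `*` I))%E.
  rewrite ge0_integralD//; first by rewrite twice.
  - by move=> z _; rewrite mule_ge0 ?skernel_ge0.
  - by apply: measurable_funeM; exact: mK.
  - by move=> z _; rewrite mule_ge0 ?skernel_ge0.
  - by apply: measurable_funeM; exact: mK.
pose y n : \bar R := (2%:E * G (u_ n) (I `*` I) + 2%:E * G u (I `*` I))%E.
(* Stated as a sum of nonnegative integrals, so that additivity holds before [G (e n)] is known to
   be finite. *)
have hy n : (\int[@leb2 R]_(z in I `*` I) h n z + G (e n) (I `*` I) = y n)%E.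
  rewrite /y -!twice// -[RHS]ge0_integralD//; last 4 first.
  - by move=> z _; rewrite mule_ge0 ?skernel_ge0.
  - by apply: measurable_funeM; exact: mK.
  - by move=> z _; rewrite mule_ge0 ?skernel_ge0.
  - by apply: measurable_funeM; exact: mK.
  rewrite -ge0_integralD//; last 3 first.
  - exact: mh.
  - by move=> z _; exact: skernel_ge0.
  - exact: mK.
  by apply: eq_integral => z _; rewrite hE subeK.
have finI := fin_interior _ Hu.
have yfin n : y n \is a fin_num.
  by rewrite fin_numD !fin_numM// fin_interior.
have y_cvg : y @ \oo --> (\int[@leb2 R]_(z in I `*` I) lim z)%E.
  rewrite ilim; apply: cvgeD; last exact: cvg_cst.
    by rewrite fin_num_adde_defl// fin_numM.
  by apply: cvgeZl => //; exact: interior_integral_cvg.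
have hy_le n : (\int[@leb2 R]_(z in I `*` I) h n z <= y n)%E.
  by rewrite -hy leeDl// integral_skernel_ge0.
have h_cvg : (\int[@leb2 R]_(z in I `*` I) h n z)%E @[n --> \oo] -->
    (\int[@leb2 R]_(z in I `*` I) lim z)%E.
  apply: (@fatou_squeeze _ _ _ (mu \x mu)%E (I `*` I) h lim mII _ _ _ _ _ y) => //.
  - by apply: emeasurable_funD; apply: measurable_funeM; exact: mK.
  - by move=> z _; rewrite adde_ge0// mule_ge0 ?skernel_ge0.
  - apply: ae_leb2 uu => z u1 u2 _; rewrite /lim -[X in _ --> X]sube0.
    have cK := skernel_cvg s u_ u z u1 u2.
    have c0 : skernel s (e n) z @[n --> \oo] --> 0%E.
      (* Writing 0 as the kernel of the zero map reduces the claim to pointwise continuity of the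
         kernel. *)
      have <- : skernel s (fun=> (0 : 'rV[R]_d)) z = 0%E.
        rewrite skernelE/= subrr /sqnorm big1 ?mul0r// => i _.
        by rewrite mxE expr0n.
      apply: (skernel_cvg s e) => /=.
        by rewrite -(subrr (u z.1)); apply: cvgB => //; exact: cvg_cst.
      by rewrite -(subrr (u z.2)); apply: cvgB => //; exact: cvg_cst.
    have cS : (2%:E * skernel s (u_ n) z + 2%:E * skernel s u z)%E
        @[n --> \oo] --> (2%:E * skernel s u z + 2%:E * skernel s u z)%E.
      by apply: cvgeD => //; [exact: cvgeZl|exact: cvg_cst].
    by apply: cvgeB cS c0.
(* The seminorm of the difference is [y n] minus the integral of [h n]; both have the same finite
   limit. *)
rewrite /gagliardo (_ : (fun n => _) =
    fun n => (y n - \int[@leb2 R]_(z in I `*` I) h n z)%E); last first.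
  apply/funext => n; rewrite -hy addeC addeK//.
  rewrite ge0_fin_numE; last exact: integral_ge0.
  by apply: (le_lt_trans (hy_le n)); rewrite ltey_eq yfin.
rewrite -(@subee _ (\int[@leb2 R]_(z in I `*` I) lim z)%E); last first.
  by rewrite ilim fin_numD !fin_numM.
apply: cvgeB => //.
by rewrite ilim fin_num_adde_defr// fin_numD !fin_numM.
Qed.

End subinterval.
End limit.
End constrained_maps.

(** * Subsequences *)

Lemma increasing_extraction (P : nat -> nat -> Prop) :
  (forall k m, exists n, (m <= n)%N /\ P k n) ->
  exists2 phi : nat -> nat,
    {homo phi : m n / (m < n)%N} & forall k, P k (phi k).
Proof.
move=> ex; pose f k m := sval (cid (ex k m)).
have fP k m : (m <= f k m)%N /\ P k (f k m) by exact: (svalP (cid (ex k m))).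
(* Each search starts at the successor of the previous index, which makes [phi] strictly
   increasing. *)
pose phi := fix phi k := if k is k'.+1 then f k (phi k').+1 else f 0%N 0%N.
exists phi; last by case=> [|k]; [exact: (fP 0 0)%N.2|exact: (fP k.+1 (phi k).+1).2].
by apply: homo_ltn => [y x z|k]; [exact: ltn_trans|exact: (fP k.+1 (phi k).+1).1].
Qed.

Lemma increasing_cvg_oo (phi : nat -> nat) :
  {homo phi : m n / (m < n)%N} -> phi @ \oo --> \oo.
Proof.
move=> phiS A [m _ mA]; exists m => // n /= mn; apply: mA => /=.
apply: leq_trans mn _; elim: n => // n IH.
by apply: leq_ltn_trans IH _; exact: phiS.
Qed.

(** If some neighbourhood of [l] were missed infinitely often, the missing terms would form a
    subsequence none of whose subsequences tends to [l]. *)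
Lemma cvg_subsequence_principle {T : topologicalType} (x_ : nat -> T) (l : T) :
  (forall phi : nat -> nat, {homo phi : m n / (m < n)%N} ->
    exists2 psi : nat -> nat, {homo psi : m n / (m < n)%N} &
      x_ (phi (psi n)) @[n --> \oo] --> l) ->
  x_ @ \oo --> l.
Proof.
move=> H A Al; apply: contrapT => nA.
have [|phi phiS nphi] := increasing_extraction (fun _ n => ~ A (x_ n)).
  move=> _ m; apply: contrapT => nex; apply: nA; exists m => // n /= mn.
  by apply: contrapT => nAn; apply: nex; exists n.
have [psi psiS /(_ _ Al)[m _ /(_ m (leqnn m))]] := H phi phiS.
exact: nphi.
Qed.

(** Indices are chosen so that the squared mass on [[-k, k]] is at most [2^-(k+1)]. The sum of the
    truncated squares is then integrable, hence finite almost everywhere, and its terms tend to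
    0. *)
Lemma L2loc_cvg_ae_subsequence {R : realType} {d : nat} (e_ : nat -> R -> 'rV[R]_d) :
  (forall n, measurable_coords (e_ n)) ->
  (forall a b : R, L2sq (e_ n) `[a, b] @[n --> \oo] --> 0%E) ->
  exists2 phi : nat -> nat, {homo phi : m n / (m < n)%N} &
    {ae @lebesgue_measure R, forall x, sqnorm (e_ (phi n) x) @[n --> \oo] --> 0}.
Proof.
move=> me e0; pose c k : R := 1 / (2 ^ (k + 1))%:R.
have c0 k : 0 < c k by rewrite divr_gt0// ltr0n expn_gt0.
have [|phi phiS phic] := increasing_extraction
    (fun k n => L2sq (e_ n) `[(- k%:R)%R, k%:R%R] <= (c k)%:E)%E.
  move=> k m; have /fine_cvgP[finL /cvgrPdist_le cL] := e0 (- k%:R) k%:R.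
  have [n1 _ n1P] := finL; have [n2 _ n2P] := cL _ (c0 k).
  exists (maxn m (maxn n1 n2)); split; first exact: leq_maxl.
  rewrite -(fineK (n1P _ _)) ?lee_fin/=; last by rewrite !leq_max leqnn/= orbT.
  have := n2P (maxn m (maxn n1 n2)); rewrite /= !leq_max leqnn !orbT => /(_ isT).
  by rewrite sub0r normrN => /(le_trans (ler_norm _)).
exists phi => //.
pose f k : R -> \bar R := (fun x => (sqnorm (e_ (phi k) x))%:E) \_ `[- k%:R, k%:R].
have f0 k x : (0 <= f k x)%E.
  by apply: erestrict_ge0 => y _; rewrite lee_fin sqnorm_ge0.
have mf k : measurable_fun setT (f k).
  apply/(measurable_restrictT _ (measurable_itv _)); apply: measurable_funTS.
  by apply/measurable_EFinP; exact: measurable_sqnorm.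
have sum_lty : (\int[lebesgue_measure]_x (\sum_(k <oo) f k x) < +oo)%E.
  rewrite integral_nneseries//.
  apply: (@le_lt_trans _ _ (\sum_(k <oo) (c k)%:E)%E).
    apply: lee_nneseries => [k _ _|k _]; first exact: integral_ge0.
    by rewrite /f -integral_mkcond; exact: phic.
  have /cvg_lim -> // := @cvg_geometric_eseries_half R 1 0.
  by rewrite ltry.
have ifs : lebesgue_measure.-integrable setT (fun x => \sum_(k <oo) f k x)%E.
  apply/integrableP; split.
    exact: (@ge0_emeasurable_sum _ _ R setT f xpredT (fun k x _ _ => f0 k x) (fun k _ => mf k)).
  under eq_integral do rewrite gee0_abs ?nneseries_ge0//.
  by [].
have := integrable_ae measurableT ifs.
apply: filterS => x /(_ I) fx.
have tail := @nneseries_tail_cvg R (f ^~ x) xpredT _ (fun k _ => f0 k x).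
have {}tail : (\sum_(N <= k <oo) f k x)%E @[N --> \oo] --> 0%E.
  by apply: tail; rewrite ltey_eq fx.
(* Each term is at most the tail of the convergent series that starts with it. *)
have fx0 : f ^~ x @ \oo --> 0%E.
  apply: (squeeze_cvge _ (cvg_cst 0%E) tail).
  apply: nearW => k; rewrite f0/=.
  rewrite (nneseries_split k 1)// addn1 big_nat1 leeDl//.
  by apply: nneseries_ge0.
have /fine_cvgP[_ ] := fx0.
apply: cvg_trans; apply: near_eq_cvg; near=> k.
rewrite /f /= patchE mem_set// /=.
(* A fixed [x] eventually lies in [[-k, k]], where the truncation has no effect. *)
have xk : `|x| <= k%:R by near: k; exact: nbhs_infty_ger.
by rewrite in_itv/= -ler_norml.
Unshelve. all: by end_near. Qed.

(** * Compactness of minimizing maps, from subsequences to the whole sequence *)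

Theorem theorem4p1 (R : realType) (s : R) (d : nat) (N : set 'rV[R]_d)
  (alpha beta : R) (u_ : nat -> R -> 'rV[R]_d) (u : R -> 'rV[R]_d) :
  0 < s -> s < 2^-1 ->
  compact N -> smooth_submanifold N ->
  alpha < beta ->
  (forall n, min_sharmonic s alpha beta N (u_ n)) ->
  (exists M : R, forall n, (energy s (u_ n) `]alpha, beta[ <= M%:E)%E) ->
  (forall i : 'I_d, measurable_fun setT (fun x => u x ord0 i)) ->
  (forall a b : R, L2sq (fun x => u_ n x - u x) `[a, b] @[n --> \oo] --> 0%E) ->
  min_sharmonic s alpha beta N u /\
  (forall a b : R, alpha < a -> a < b -> b < beta ->
     L2sq (fun x => u_ n x - u x) `]a, b[ @[n --> \oo] --> 0%E /\
     gagliardo s (fun x => u_ n x - u x) `]a, b[ @[n --> \oo] --> 0%E /\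
     energy s (u_ n) `]a, b[ @[n --> \oo] --> energy s u `]a, b[).
Proof.
move=> s0 s1 cN _ ab minu [M EM] mcu L2u.
have clN : closed N by apply: compact_closed cN; exact: norm_hausdorff.
have [C C0 NC] := compact_sqnorm_bounded N cN.
have mcu_ n : measurable_coords (u_ n) by have [[[[]]]] := minu n.
have sub (phi : nat -> nat) : {homo phi : m n / (m < n)%N} ->
    exists2 psi : nat -> nat, {homo psi : m n / (m < n)%N} &
      {ae @lebesgue_measure R, forall x, u_ (phi (psi n)) x @[n --> \oo] --> u x}.
  move=> phiS; have [||psi psiS psiP] :=
      L2loc_cvg_ae_subsequence (fun n x => u_ (phi n) x - u x).
  - by move=> n; exact: measurable_coordsB.
  - move=> a b; apply: (cvg_comp phi (fun n => L2sq (fun x => u_ n x - u x) `[a, b])).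
      exact: increasing_cvg_oo.
    exact: L2u.
  by exists psi => //; apply: filterS psiP => x; exact: cvg_of_sqnorm.
split.
  (* A single almost everywhere convergent subsequence suffices for the minimality of [u]. *)
  have [psi _ psiP] := sub id (fun m n mn => mn).
  split.
    apply: (HhatN_limit s alpha beta N C s0 s1 ab C0 NC (fun n => u_ (psi n)) u M) => //.
    by move=> n; have [] := minu (psi n).
  move=> v Hv [a [b [aa [bb vu]]]].
  (* The given [a] and [b] need not satisfy [a < b]. The midpoint [m] is used to form [a' < b']
     inside []alpha, beta[] with [[a, b]] contained in []a', b'[]. *)
  pose m := (alpha + beta) / 2.
  pose a' := (alpha + Num.min a m) / 2; pose b' := (Num.max b m + beta) / 2.
  have [am ma mb bm] : [/\ Num.min a m <= a, Num.min a m <= m,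
      m <= Num.max b m & b <= Num.max b m].
    by rewrite !ge_min !le_max !lexx !orbT.
  have [mlo mhi] : alpha < Num.min a m /\ Num.max b m < beta.
    by rewrite lt_min gt_max aa bb /m; split; lra.
  apply: (energy_le_competitor s alpha beta N C s0 s1 ab C0 NC
    (fun n => u_ (psi n)) u M clN _ _ mcu psiP a' b') => //.
  - by rewrite /a'; lra.
  - by rewrite /a' /b'; lra.
  - by rewrite /b'; lra.
  apply: filterS vu => x vx xab; apply: vx => xin; apply: xab; move: xin.
  by rewrite /= !in_itv/= /a' /b' => /andP[? ?]; apply/andP; split; lra.
move=> a b aa altb bb; split; [|split].
- have L2ge0 n (A : set R) : (0 <= L2sq (fun x => (u_ n x - u x)%R) A)%E.
    by apply: integral_ge0 => x _; rewrite lee_fin sqnorm_ge0.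
  apply: (squeeze_cvge _ (cvg_cst 0%E) (L2u a b)).
  apply: nearW => n; rewrite L2ge0/=.
  apply: ge0_subset_integral => //.
  + apply: measurable_funTS; apply/measurable_EFinP; apply: measurable_sqnorm.
    exact: measurable_coordsB.
  + by move=> x _; rewrite lee_fin sqnorm_ge0.
  + exact: subset_itvW.
- apply: cvg_subsequence_principle => phi /sub[psi psiS psiP]; exists psi => //.
  exact: (gagliardo_subinterval_cvg s alpha beta N C s0 s1 ab C0 NC
    (fun n => u_ (phi (psi n))) u M clN _ _ mcu psiP).
- apply: cvg_subsequence_principle => phi /sub[psi psiS psiP]; exists psi => //.
  exact: (energy_subinterval_cvg s alpha beta N C s0 s1 ab C0 NC
    (fun n => u_ (phi (psi n))) u M clN _ _ mcu psiP).
Qed.
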